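(* Let $G$ be a finite simple graph and $n$ a positive integer. Then the pegging number of the Cartesian product $G \times K_n$ satisfies $P(G \times K_n) \le \pi_2(G)$. Furthermore, $P(G \times K_2) \le \max\{\pi(G), |G|+1\}$.
   Context: All graphs are finite and simple; $|G|$ denotes the number of vertices of $G$ and $K_n$ the complete graph on $n$ vertices. The Cartesian product $G \times H$ has vertex set $V(G)\times V(H)$, with $(g,h)$ adjacent to $(g',h')$ iff either $g=g'$ and $hh' \in E(H)$, or $h=h'$ and $gg'\in E(G)$. Pegging: a distribution of pegs on a graph $\Gamma$ is a subset $D \subseteq V(\Gamma)$. If $u,v \in D$ are distinct adjacent vertices and $w \notin D$ is a vertex adjacent to $v$, the pegging move (jumping $u$ over $v$ into $w$) replaces $D$ by $(D\setminus\{u,v\})\cup\{w\}$. A vertex $t$ is reachable from $D$ if some finite (possibly empty) sequence of pegging moves starting from $D$ ends in a distribution containing $t$; $\mathrm{Reach}(D)$ is the set of reachable vertices. The pegging number $P(\Gamma)$ is the smallest positive integer $d$ such that every distribution of size $d$ on $\Gamma$ has reach $V(\Gamma)$. Pebbling: a pebble distribution on $G$ assigns a nonnegative integer number of pebbles to each vertex; a pebbling move removes two pebbles from one vertex and places one pebble on an adjacent vertex. The pebbling number $\pi(G)$ (respectively two-pebbling number $\pi_2(G)$) is the smallest positive integer $p$ such that for every pebble distribution with $p$ pebbles in total and every vertex $t$, some sequence of pebbling moves places at least one pebble (respectively at least two pebbles) on $t$. These are taken to be infinite if $G$ is disconnected. *)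

(* Defs.v *)
From Stdlib Require Import Relation_Operators.
From mathcomp Require Import all_boot.
From mathcomp Require Import boolp.

Set Implicit Arguments.
Unset Strict Implicit.
Unset Printing Implicit Defensive.

Record sgraph : Type := SGraph {
  vertex :> finType;
  edge : rel vertex;
  edge_sym : symmetric edge;
  edge_irrefl : irreflexive edge
}.

Definition complete_edge (n : nat) : rel 'I_n := fun i j => i != j.

Lemma complete_edge_sym n : symmetric (@complete_edge n).
Proof. by move=> i j; rewrite /complete_edge eq_sym. Qed.

Lemma complete_edge_irrefl n : irreflexive (@complete_edge n).
Proof. by move=> i; rewrite /complete_edge eqxx. Qed.

Definition complete_graph (n : nat) : sgraph :=
  SGraph (@complete_edge_sym n) (@complete_edge_irrefl n).

Definition cart_edge (G H : sgraph) : rel (G * H)%type := fun x y =>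
  ((x.1 == y.1) && edge x.2 y.2) || ((x.2 == y.2) && edge x.1 y.1).

Lemma cart_edge_sym G H : symmetric (@cart_edge G H).
Proof.
by move=> x y; rewrite /cart_edge ![y.1 == _]eq_sym ![y.2 == _]eq_sym
   (edge_sym y.1) (edge_sym y.2).
Qed.

Lemma cart_edge_irrefl G H : irreflexive (@cart_edge G H).
Proof. by move=> x; rewrite /cart_edge !edge_irrefl !andbF. Qed.

Definition cart_prod (G H : sgraph) : sgraph :=
  SGraph (@cart_edge_sym G H) (@cart_edge_irrefl G H).

Section Pegging.
Variable G : sgraph.

Definition peg_move : rel {set G} := fun D D' =>
  [exists u, exists v, exists w,
    [&& u \in D, v \in D, edge u v, w \notin D, edge v w
      & D' == w |: (D :\: [set u; v])]].

Definition peg_reach (D : {set G}) : {set G} :=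
  [set t | [exists D', connect peg_move D D' && (t \in D')]].

Definition pegging_suffices (d : nat) : bool :=
  (0 < d) && [forall D : {set G}, (#|D| == d) ==> (peg_reach D == [set: G])].

(* Vacuous: no distribution has more than #|G| pegs. *)
Lemma pegging_suffices_ex : exists d, pegging_suffices d.
Proof.
exists #|G|.+1; rewrite /pegging_suffices /=; apply/forallP=> D.
by apply/implyP=> /eqP cD; have := max_card (mem D); rewrite cD ltnn.
Qed.

Definition pegging_number : nat := ex_minn pegging_suffices_ex.

End Pegging.

(* Extended natural numbers: None stands for infinity. *)
Definition enat : Type := option nat.

Definition enat_le (a b : enat) : bool :=
  match a, b with
  | _, None => true
  | None, Some _ => false
  | Some m, Some n => m <= n
  end.

Definition enat_max (a b : enat) : enat :=
  match a, b with
  | Some m, Some n => Some (maxn m n)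
  | _, _ => None
  end.

Definition least_positive (Q : nat -> Prop) : enat :=
  match pselect (exists n, `[< 0 < n /\ Q n >]) with
  | left exQ => Some (ex_minn exQ)
  | right _ => None
  end.

Section Pebbling.
Variable G : sgraph.
Implicit Types f g : {ffun G -> nat}.

Definition pebble_move f g : Prop :=
  exists u v : G, [/\ edge u v, 2 <= f u &
    g = [ffun x => if x == u then f x - 2
                   else if x == v then (f x).+1 else f x]].

Definition pebble_reach f g : Prop := clos_refl_trans _ pebble_move f g.

Definition pebbling_suffices (k p : nat) : Prop :=
  forall f, \sum_(x : G) f x = p ->
  forall t : G, exists g, pebble_reach f g /\ k <= g t.

Definition pebbling_number : enat := least_positive (pebbling_suffices 1).

Definition two_pebbling_number : enat := least_positive (pebbling_suffices 2).

(* The convention that both numbers are infinite on disconnected graphs is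
   not built into the definitions: it is a consequence of them. *)
Lemma pebbling_disconnected k (x y : G) :
  0 < k -> ~~ connect (@edge G) x y ->
  least_positive (pebbling_suffices k) = None.
Proof.
move=> k0 nxy; rewrite /least_positive; case: pselect => // exP.
exfalso; case: exP => p /asboolP[_ Hp].
pose f : {ffun G -> nat} := [ffun z => if z == x then p else 0].
have fp : \sum_z f z = p.
  rewrite (bigD1 x) //= ffunE eqxx big1 ?addn0 // => z /negPf zx.
  by rewrite ffunE zx.
have [g [fg gy]] := Hp f fp y.
pose S (h : {ffun G -> nat}) := forall z, 0 < h z -> connect (@edge G) x z.
have Sf : S f by move=> z; rewrite ffunE; case: eqP => // ->; rewrite connect0.
suff Sg : S g by move: nxy; rewrite Sg // (leq_trans k0).
elim: fg Sf => // [a b [u [v [uv au ->]]] Sa z|a b c _ IH1 _ IH2 /IH1 /IH2 //].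
rewrite ffunE; case: (z =P u) => [-> _|_]; first exact/Sa/ltnW.
case: (z =P v) => [-> _|_ /Sa //].
by apply: connect_trans (connect1 uv); apply/Sa/ltnW.
Qed.

End Pebbling.

(* Main.v *)
(** Pegs on the fiber over [x] play the role of pebbles on [x]: two pegs on the
fiber over [u] can produce one on the fiber over a neighbor [v], on a level
occupied over [u] and free over [v].  Such a level exists as soon as [v] carries
at most one peg, so it suffices to pebble using only moves into vertices with at
most one pebble.  To get such a sequence, forget the order of the moves and keep
only the number of moves along each arc, subject to the balance condition that
no vertex spends more than it owns and receives.  If no move can be played into
a vertex with at most one pebble, then either a move feeds a vertex that spends
nothing, and can be dropped, or the moves contain a cycle, which can be dropped.

For [n = 2] and a target over an empty fiber, the first move entering that
fiber can choose its level.  Otherwise let [C] be the component of [t] among the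
occupied vertices.  A second peg on a fiber over [C], or a peg next to [C] on
the level of its neighbor in [C], can be pushed to [t] inside [C].  If each
fiber over [C] has exactly one peg, counting pegs gives an empty vertex [z]
next to [C]; pebble towards [z] and stop when [C] or [z] is about to be
entered. *)

From Stdlib Require Import Operators_Properties.
From mathcomp Require Import all_boot.
From mathcomp Require Import boolp zify.
Require Import Defs.

Set Implicit Arguments.
Unset Strict Implicit.
Unset Printing Implicit Defensive.

(** * Unordered families of pebbling moves and how to play them *)

Section MoveSets.
Variable G : sgraph.
Implicit Types (f g : {ffun G -> nat}) (M N : G -> G -> nat) (u v w r : G).

Definition outdeg M v := \sum_w M v w.
Definition indeg M v := \sum_w M w v.
Definition total M := \sum_v outdeg M v.

(** A necessary condition for playing the moves counted by [M] in some order and keeping [k] pebbles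
    on [r]. No order is recorded, so cycles are allowed. *)
Definition balanced k r f M :=
  (forall v w, 0 < M v w -> edge v w) /\
  (forall v, 2 * outdeg M v + (if v == r then k else 0) <= f v + indeg M v).

Definition single u w : G -> G -> nat := fun x y => (x == u) && (y == w).

Definition sub_moves M N : G -> G -> nat := fun x y => M x y - N x y.

Lemma outdeg_sub M N v :
  (forall x y, N x y <= M x y) ->
  outdeg M v = outdeg (sub_moves M N) v + outdeg N v.
Proof.
move=> NM; rewrite /outdeg -big_split; apply: eq_bigr => w _.
by rewrite /sub_moves /= subnK.
Qed.

Lemma indeg_sub M N v :
  (forall x y, N x y <= M x y) ->
  indeg M v = indeg (sub_moves M N) v + indeg N v.
Proof.
move=> NM; rewrite /indeg -big_split; apply: eq_bigr => w _.
by rewrite /sub_moves /= subnK.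
Qed.

Lemma total_indeg M : total M = \sum_v indeg M v.
Proof. exact: exchange_big. Qed.

Lemma total_sub_lt M N v :
  (forall x y, N x y <= M x y) -> 0 < outdeg N v -> total (sub_moves M N) < total M.
Proof.
move=> NM Nv.
have -> : total M = total (sub_moves M N) + total N.
  by rewrite /total -big_split; apply: eq_bigr => x _; apply: outdeg_sub.
by rewrite -addn1 leq_add2l /total (bigD1 v) //=; lia.
Qed.

Lemma outdeg_single u w v : outdeg (single u w) v = (v == u).
Proof.
rewrite /outdeg /single; case: eqP => _ /=; last by rewrite big1.
by rewrite (bigD1 w) //= eqxx big1 ?addn0 // => y /negPf ->.
Qed.

Lemma indeg_single u w v : indeg (single u w) v = (v == w).
Proof.
rewrite /indeg /single; case: eqP => _ /=; last by rewrite big1 // => y _; rewrite andbF.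
by rewrite (bigD1 u) //= eqxx big1 ?addn0 // => y /negPf ->.
Qed.

Lemma single_le M u w : 0 < M u w -> forall x y, single u w x y <= M x y.
Proof. by move=> Muw x y; rewrite /single; case: eqP => //= ->; case: eqP => //= ->. Qed.

Lemma outdeg_gt0 M v : 0 < outdeg M v -> exists w, 0 < M v w.
Proof.
move=> ov; apply/existsP; apply: contraLR ov; rewrite negb_exists => /forallP h.
by rewrite /outdeg big1 // => w _; have := h w; lia.
Qed.

(** The first alternative covers playing a move and deleting a cycle. The second covers deleting a
    move into a vertex other than [r] that spends nothing, where the balance condition is void. *)
Lemma balanced_sub k r f g M N :
  balanced k r f M -> (forall x y, N x y <= M x y) ->
  (forall v, f v + indeg N v <= g v + 2 * outdeg N v
             \/ outdeg M v = 0 /\ v != r) ->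
  balanced k r g (sub_moves M N).
Proof.
move=> [eM bM] NM h; split=> [v w|v].
  by rewrite /sub_moves => Mvw; apply: eM; lia.
have := bM v; have := outdeg_sub v NM; have := indeg_sub v NM.
by case: (h v) => [|[-> /negPf ->]]; lia.
Qed.

(* Otherwise [outdeg <= indeg] everywhere, strictly at the target, although
   both sum up to the number of moves. *)
Lemma balanced_ready k r f M :
  balanced k r f M -> f r < k -> exists v, 0 < outdeg M v /\ 2 <= f v.
Proof.
move=> [_ bM] fr.
have [/existsP[v /andP[? ?]]|] := boolP [exists v, (0 < outdeg M v) && (1 < f v)].
  by exists v.
rewrite negb_exists => /forallP h; exfalso.
have le v : outdeg M v + (v == r) <= indeg M v.
  have := bM v; have := h v; case: eqP => [->|]; lia.
have : \sum_v (outdeg M v + (v == r)) <= \sum_v indeg M v by apply: leq_sum.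
rewrite -total_indeg big_split /= -/(total M) (bigD1 r) //= eqxx; lia.
Qed.

Definition pebble_step f u v : {ffun G -> nat} :=
  [ffun x => if x == u then f x - 2 else if x == v then (f x).+1 else f x].

Inductive slow_reach : {ffun G -> nat} -> {ffun G -> nat} -> Prop :=
| slow_refl f : slow_reach f f
| slow_step f g u v : edge u v -> 2 <= f u -> f v <= 1 ->
    slow_reach (pebble_step f u v) g -> slow_reach f g.

Lemma edge_neq u v : edge u v -> u != v.
Proof. by apply: contraTneq => ->; rewrite edge_irrefl. Qed.

(** The image of a minimal nonempty [s]-closed set is again [s]-closed, hence equals it, and a
    surjection of a finite set onto itself is injective. So [C] is made of cycles of [s]. *)
Lemma minimal_closed_set (T : finType) (s : T -> T) (B : {set T}) :
  B != set0 -> (forall x, x \in B -> s x \in B) ->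
  exists C : {set T}, [/\ C != set0, C \subset B, s @: C = C & {in C &, injective s}].
Proof.
move=> B0 sB.
pose P (C : {set T}) := (C != set0) && (s @: C \subset C).
have PB : P B by rewrite /P B0; apply/subsetP=> _ /imsetP[x xB ->]; apply: sB.
have [C minC CB] := minset_exists PB.
have /andP[C0 sC] := minsetp minC.
have sCE : s @: C = C.
  apply: (minsetinf minC) => //; apply/andP; split; last exact: imsetS.
  by case/set0Pn: C0 => x xC; apply/set0Pn; exists (s x); apply: imset_f.
by exists C; split=> //; apply/imset_injP; rewrite sCE.
Qed.

Lemma slow_pebbling k r f M :
  k <= 2 -> balanced k r f M -> exists g, slow_reach f g /\ k <= g r.
Proof.
move=> k2; have [m] := ubnP (total M); elim: m f M => // m IH f M tM bM.
have [kr|frk] := leqP k (f r); first by exists f; split=> //; apply: slow_refl.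
have [v0 [ov0 fv0]] := balanced_ready bM frk.
have [eM bMv] := bM.
pose B := [set v | (0 < outdeg M v) && (2 <= f v)].
have [/existsP[u /andP[uB /existsP[w /andP[Muw fw]]]]|noslow] :=
    boolP [exists u in B, exists w, (0 < M u w) && (f w <= 1)].
  have sM := single_le Muw.
  move: uB; rewrite inE => /andP[_ fu].
  have uw := eM _ _ Muw; have /negPf unw := edge_neq uw.
  have [||g [fg kg]] := IH (pebble_step f u w) (sub_moves M (single u w)).
  - have := total_sub_lt (v := u) sM; rewrite outdeg_single eqxx; lia.
  - apply: balanced_sub bM sM _ => v; left.
    rewrite outdeg_single indeg_single ffunE.
    by case: (v =P u) => [->|_]; rewrite ?unw /=; last case: (v == w); lia.
  by exists g; split=> //; apply: slow_step fg.
have fB u w : u \in B -> 0 < M u w -> 2 <= f w.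
  move=> uB Muw; rewrite ltnNge; apply: contra noslow => fw.
  by apply/existsP; exists u; rewrite uB; apply/existsP; exists w; rewrite Muw.
have [/existsP[u /andP[uB /existsP[w /andP[Muw /eqP ow]]]]|nodead] :=
    boolP [exists u in B, exists w, (0 < M u w) && (outdeg M w == 0)].
  have sM := single_le Muw.
  apply: (IH f (sub_moves M (single u w))).
    have := total_sub_lt (v := u) sM; rewrite outdeg_single eqxx; lia.
  apply: balanced_sub bM sM _ => v; rewrite outdeg_single indeg_single.
  case: (v =P w) => [->|_]; last by left; lia.
  (* Here [w] holds at least two pebbles, so it is not [r], which holds fewer than [k <= 2]. *)
  right; split=> //; apply: contraTneq frk => <-; have := fB _ _ uB Muw; lia.
pose s u := odflt u [pick w | 0 < M u w].
have sP u : u \in B -> 0 < M u (s u).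
  rewrite inE /s => /andP[/outdeg_gt0[w Muw] _]; case: pickP => //= /(_ w).
  by rewrite Muw.
have sB u : u \in B -> s u \in B.
  move=> uB; rewrite inE (fB u) ?sP // andbT lt0n; apply: contra nodead => os.
  by apply/existsP; exists u; rewrite uB; apply/existsP; exists (s u); rewrite sP.
have B0 : B != set0 by apply/set0Pn; exists v0; rewrite inE ov0.
have [C [C0 CB sC injs]] := minimal_closed_set B0 sB.
(* In [N] each vertex of [C] spends one move and receives one; dropping both frees two pebbles there
   and costs one. *)
pose N : G -> G -> nat := fun x y => (x \in C) && (y == s x).
have NM x y : N x y <= M x y.
  rewrite /N; case: (boolP (x \in C)) => //= xC; case: eqP => //= ->.
  exact/sP/(subsetP CB).
have oN v : outdeg N v = (v \in C).
  rewrite /outdeg /N; case: (v \in C); last by rewrite big1.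
  by rewrite (bigD1 (s v)) //= eqxx big1 ?addn0 // => y /negPf ->.
have iN v : indeg N v = (v \in C).
  rewrite /indeg /N; case: (boolP (v \in C)) => [|vC].
    rewrite -{1}sC => /imsetP[x xC ->]; rewrite (bigD1 x) //= xC eqxx big1 //.
    move=> y yx; case: (boolP (y \in C)) => //= yC.
    by rewrite (inj_in_eq injs) // eq_sym (negPf yx).
  rewrite big1 // => x _; case: (boolP (x \in C)) => //= xC.
  by case: eqP vC => // ->; rewrite -sC imset_f.
apply: (IH f (sub_moves M N)).
  case/set0Pn: C0 => x xC.
  have := total_sub_lt (v := x) NM; rewrite oN xC; lia.
by apply: balanced_sub bM NM _ => v; left; rewrite oN iN; lia.
Qed.

(** Read from the first move on: adding a move to [M] shifts the balance exactly as playing it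
    shifts the distribution. *)
Lemma pebble_reach_balanced k r f g :
  pebble_reach f g -> k <= g r -> exists M, balanced k r f M.
Proof.
move=> fg; have {fg} := clos_rt_rt1n _ _ _ _ fg; elim=> {f g} [f kf|f f' g [u [v [uv fu ->]]] _ IH /IH [M [eM bM]]].
  exists (fun _ _ => 0); split=> // v; rewrite /outdeg /indeg !big1 //.
  by case: eqP => [->|]; lia.
exists (fun x y => M x y + single u v x y); split=> [x y|x].
  rewrite addn_gt0 => /orP[/eM //|]; rewrite /single; case: eqP => //= ->.
  by case: eqP => // ->.
rewrite /outdeg /indeg !big_split /=.
rewrite -/(outdeg M x) -/(indeg M x) -/(outdeg (single u v) x) -/(indeg (single u v) x).
rewrite outdeg_single indeg_single; have := bM x; rewrite ffunE.
have /negPf unv := edge_neq uv.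
by case: (x =P u) => [->|_]; rewrite ?unv /=; last case: (x == v) => /=; lia.
Qed.

(** [pebbling_suffices] speaks of exactly [p] pebbles; this makes it usable on larger
    distributions. *)
Lemma subdistribution f p :
  p <= \sum_x f x -> exists g, (forall x, g x <= f x) /\ \sum_x g x = p.
Proof.
move=> pf; have [m] := ubnP (\sum_x f x); elim: m f pf => // m IH f pf fm.
have [pE|pN] := eqVneq (\sum_x f x) p; first by exists f.
have [x fx] : exists x, 0 < f x.
  apply/existsP; have : \sum_x f x != 0 by lia.
  apply: contraNT; rewrite negb_exists => /forallP h; rewrite big1 // => x _.
  by have := h x; lia.
pose f' : {ffun G -> nat} := [ffun y => f y - (y == x)].
have sf : \sum_y f y = (\sum_y f' y).+1.
  have rest : \sum_(y | y != x) f' y = \sum_(y | y != x) f y.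
    by apply: eq_bigr => y /negPf yx; rewrite ffunE yx subn0.
  rewrite (bigD1 x) //= [in RHS](bigD1 x) //= rest ffunE eqxx /=; lia.
have [||g [gf' gp]] := IH f'; [lia|lia|].
by exists g; split=> // y; apply: leq_trans (gf' y) _; rewrite ffunE leq_subr.
Qed.

Lemma slow_pebbling_suffices k p f r :
  k <= 2 -> pebbling_suffices G k p -> p <= \sum_x f x ->
  exists g, slow_reach f g /\ k <= g r.
Proof.
move=> k2 Gp /subdistribution[f' [f'f f'p]].
have [g [f'g kg]] := Gp f' f'p r.
have [M [eM bM]] := pebble_reach_balanced f'g kg.
(* Balance survives adding pebbles, so the moves found for [f'] also serve [f]. *)
apply: (@slow_pebbling k r f M k2); split=> // v.
by apply: leq_trans (bM v) _; rewrite leq_add2r.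
Qed.

End MoveSets.

(** * Elementary pegging moves *)

Section Pegging.
Variable G : sgraph.

Lemma peg_jump (D : {set G}) u v w :
  u \in D -> v \in D -> edge u v -> w \notin D -> edge v w ->
  peg_move D (w |: (D :\: [set u; v])).
Proof.
move=> uD vD uv wD vw; apply/existsP; exists u; apply/existsP; exists v.
by apply/existsP; exists w; rewrite uD vD uv wD vw eqxx.
Qed.

Lemma peg_reach_self (D : {set G}) t : t \in D -> t \in peg_reach D.
Proof. by move=> tD; rewrite inE; apply/existsP; exists D; rewrite connect0. Qed.

Lemma peg_reach_trans (D D' : {set G}) t :
  connect (@peg_move G) D D' -> t \in peg_reach D' -> t \in peg_reach D.
Proof.
move=> DD'; rewrite !inE => /existsP[E /andP[D'E tE]]; apply/existsP; exists E.
by rewrite tE (connect_trans DD').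
Qed.

Lemma peg_reach_jump (D : {set G}) u v w :
  u \in D -> v \in D -> edge u v -> edge v w -> w \in peg_reach D.
Proof.
move=> uD vD uv vw; have [wD|wD] := boolP (w \in D); first exact: peg_reach_self.
apply: peg_reach_trans (connect1 (peg_jump uD vD uv wD vw)) _.
by apply: peg_reach_self; rewrite setU11.
Qed.

End Pegging.

(** * Simulation of pebbling by pegs on fibers *)

Section Fibers.
Variables (G : sgraph) (n : nat).
Notation GK := (cart_prod G (complete_graph n)).
Implicit Types (D : {set GK}) (u v x : G) (i j : 'I_n).

Definition fiber D x : {set 'I_n} := [set i | (x, i) \in D].

Definition fiber_count D : {ffun G -> nat} := [ffun x => #|fiber D x|].

Lemma sum_fiber_count D : \sum_x fiber_count D x = #|D|.
Proof.
under eq_bigr do rewrite ffunE -sum1_card.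
rewrite pair_big_dep /= -sum1_card; apply: eq_bigl => -[x i].
by rewrite inE.
Qed.

Lemma edge_vertical x i j : edge ((x, i) : GK) (x, j) = (i != j).
Proof. by rewrite /= /cart_edge /= eqxx edge_irrefl andbF orbF. Qed.

Lemma edge_horizontal x y i : edge ((x, i) : GK) (y, i) = edge x y.
Proof. by rewrite /= /cart_edge /= /complete_edge !eqxx andbF. Qed.

Lemma simulate_pebble_step D u v :
  edge u v -> 2 <= fiber_count D u -> fiber_count D v <= 1 ->
  exists D' : {set GK}, [/\ peg_move D D',
    fiber_count D' = pebble_step (fiber_count D) u v &
    forall x i, x != u -> x != v -> ((x, i) \in D') = ((x, i) \in D)].
Proof.
move=> uv; rewrite !ffunE => cu cv; have /negPf unv := edge_neq uv.
have [j ju jv] : exists2 j, j \in fiber D u & j \notin fiber D v.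
  apply/subsetPn; apply/negP => /subset_leq_card; lia.
have [i iu ij] : exists2 i, i \in fiber D u & i != j.
  have : 0 < #|fiber D u :\ j| by rewrite (cardsD1 j) ju in cu.
  by case/card_gt0P=> i; rewrite !inE => /andP[ij iD]; exists i; rewrite ?inE.
(* The peg at [(u, i)] jumps over [(u, j)] into [(v, j)]. *)
pose D' : {set GK} := (v, j) |: (D :\: [set (u, i); (u, j)]).
have fD' x l : (l \in fiber D' x) = (x == v) && (l == j) ||
    ~~ ((x == u) && ((l == i) || (l == j))) && (l \in fiber D x).
  by rewrite !inE !xpair_eqE -andb_orr.
exists D'; split.
- rewrite !inE in iu ju jv.
  by apply: peg_jump; rewrite ?edge_vertical ?edge_horizontal.
- apply/ffunP=> x; rewrite !ffunE.
  case: (x =P u) => [->|/eqP/negPf xu].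
    rewrite (cardsD1 j (fiber D u)) ju (cardsD1 i (fiber D u :\ j)) in_setD1 ij iu.
    rewrite addnA addKn; apply: eq_card => l.
    by rewrite fD' !in_setD1 unv eqxx negb_or andbA.
  case: (x =P v) => [->|/eqP/negPf xv].
    transitivity #|j |: fiber D v|; last by rewrite cardsU1 jv.
    by apply: eq_card => l; rewrite fD' in_setU1 eqxx [v == u]eq_sym unv.
  by apply: eq_card => l; rewrite fD' xu xv.
by move=> x l /negPf xu /negPf xv; have := fD' x l; rewrite xu xv !inE.
Qed.

Lemma simulate_slow_reach D g :
  slow_reach (fiber_count D) g ->
  exists2 D', connect (@peg_move GK) D D' & fiber_count D' = g.
Proof.
move fD: (fiber_count D) => f Dg; elim: Dg D fD => {f g} [f D <-|f g u v uv fu fv _ IH D fD].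
  by exists D.
subst f; have [D1 [DD1 cD1 _]] := simulate_pebble_step uv fu fv.
by have [D' D1D' <-] := IH D1 cD1; exists D' => //; apply: connect_trans (connect1 DD1) _.
Qed.

(* The simulation is stopped just before the first pebbling move into [T]. *)
Lemma simulate_until_entering D g (T : {set G}) r :
  slow_reach (fiber_count D) g -> r \in T -> fiber_count D r < g r ->
  (forall x, x \in T -> fiber_count D x <= 1) ->
  exists D' u v, [/\ connect (@peg_move GK) D D', edge u v, u \notin T, v \in T
    & 2 <= fiber_count D' u /\
      forall x i, x \in T -> ((x, i) \in D') = ((x, i) \in D)].
Proof.
move fD: (fiber_count D) => f Dg rT; elim: Dg D fD => {f g} [f D _|].
  by rewrite ltnn.
move=> f g u v uv fu fv _ IH D fD fr fT; subst f.
have uT : u \notin T by apply: contraTN fu => /fT; lia.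
have [vT|vT] := boolP (v \in T); first by exists D, u, v; split.
have notT x : x \in T -> (x != u) && (x != v).
  by move=> xT; rewrite !(memPn _ x xT).
have step_T x : x \in T -> pebble_step (fiber_count D) u v x = fiber_count D x.
  by move/notT=> /andP[/negPf xu /negPf xv]; rewrite ffunE xu xv.
have [D1 [DD1 cD1 D1E]] := simulate_pebble_step uv fu fv.
have [||D' [u' [v' [D1D' uv' u'T v'T [fu' D'E]]]]] := IH D1 cD1.
- by rewrite step_T.
- by move=> x xT; rewrite step_T ?fT.
exists D', u', v'; split=> //; first exact: connect_trans (connect1 DD1) _.
by split=> // x i xT; have /andP[xu xv] := notT _ xT; rewrite D'E // D1E.
Qed.

(** The levels of a fiber are pairwise adjacent, so one peg can jump over another into a free level
    [i]. *)
Lemma peg_reach_fiber D t i : 2 <= fiber_count D t -> (t, i) \in peg_reach D.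
Proof.
rewrite ffunE => ct; have [iD|iD] := boolP (((t, i) : GK) \in D).
  exact: peg_reach_self.
have [j jt] : exists j, j \in fiber D t by apply/card_gt0P/ltnW.
have [l] : exists l, l \in fiber D t :\ j.
  by apply/card_gt0P; rewrite (cardsD1 j) jt in ct.
case/setD1P=> lj; rewrite inE in jt => lt; rewrite inE in lt.
apply: (@peg_reach_jump GK D (t, l) (t, j)); rewrite // edge_vertical //.
by apply: contraNneq iD => <-.
Qed.

End Fibers.

(** * Pushing pegs through occupied fibers when there are two levels *)

Section TwoLevels.
Variable G : sgraph.
Notation GK := (cart_prod G (complete_graph 2)).
Implicit Types (D : {set GK}) (x y t : G) (i l : 'I_2).

Lemma other_level i : exists j, j != i.
Proof. by exists (rev_ord i); case: i => [[|[]]]. Qed.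

Lemma full_fiber D x i : 2 <= fiber_count D x -> (x, i) \in D.
Proof.
rewrite ffunE => cx; have : fiber D x == setT.
  by rewrite eqEcard subsetT cardsT card_ord.
by move/eqP/setP/(_ i); rewrite !inE.
Qed.

Lemma mem_fiber_neq D x i l m :
  (x, i) \in D -> (x, l) \in D -> i != l -> (x, m) \in D.
Proof.
move=> xi xl il; apply: full_fiber; rewrite ffunE.
apply: leq_trans (_ : #|[set i; l]| <= _); first by rewrite cards2 il.
by apply/subset_leq_card/subsetP=> a; rewrite !inE => /orP[] /eqP ->.
Qed.

(* Two adjacent pegs on one level walk along the path; where the next vertex
   carries its peg on the other level, a jump fills its whole fiber. *)
Lemma push_along_path D x y p t l i :
  (x, l) \in D -> (y, l) \in D -> edge x y -> path (@edge G) y p ->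
  last y p = t -> uniq [:: x, y & p] ->
  (forall v, v \in p -> exists m, (v, m) \in D) -> (t, i) \in peg_reach D.
Proof.
have [m] := ubnP (size p); elim: m D x y p l => // m IH D x y [|y1 p] l.
  (* At the end of the path, the jump may turn vertically into the other level. *)
  move=> _ xD yD xy _ <- _ _; have [<-|li] := eqVneq l i; first exact: peg_reach_self.
  by apply: peg_reach_jump xD yD _ _; rewrite ?edge_horizontal ?edge_vertical.
move=> pm xD yD xy /andP[yy1 y1p] lastp Uxyp occ.
have [y1D|y1D] := boolP (((y1, l) : GK) \in D).
  apply: (IH D y y1 p l) => //; first by case/andP: Uxyp.
  by move=> v vp; apply: occ; rewrite inE vp orbT.
have [l1 l1D] := occ y1 (mem_head _ _).
have jump : peg_move D ((y1, l) |: (D :\: [set (x, l); (y, l)])).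
  by apply: peg_jump => //; rewrite edge_horizontal.
apply: peg_reach_trans (connect1 jump) _.
set D' := _ |: _.
have keep v j : v \in y1 :: p -> (v, j) \in D -> (v, j) \in D'.
  move=> vp vD; rewrite !inE !xpair_eqE vD andbT.
  case/and3P: Uxyp; rewrite inE negb_or => /andP[_ xp] yp _.
  by rewrite (negPf (memPn xp _ vp)) (negPf (memPn yp _ vp)) orbT.
have full j : (y1, j) \in D'.
  apply: (@mem_fiber_neq _ _ l l1); first by rewrite setU11.
    by apply: keep; rewrite ?mem_head.
  by apply: contraNneq y1D => ->.
case: p => [|y2 p] in pm y1p lastp Uxyp occ keep *.
  by rewrite -lastp; apply: peg_reach_self.
have [l2 l2D] : exists j, (y2, j) \in D by apply: occ; rewrite !inE eqxx orbT.
case/andP: y1p => y12 y2p.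
(* The full fiber over [y1] has a peg on the level [l2] of [y2]. The path lost two vertices at once,
   hence the induction on its length. *)
apply: (IH D' y1 y2 p l2) => //; first by rewrite /= in pm; lia.
- by apply: keep; rewrite // !inE eqxx orbT.
- by case/and3P: Uxyp.
move=> v vp; have [j vD] : exists j, (v, j) \in D by apply: occ; rewrite !inE vp !orbT.
by exists j; apply: keep; rewrite // !inE vp !orbT.
Qed.

Definition occupied D : pred G := fun x => 0 < fiber_count D x.

Lemma occupiedP D x : reflect (exists l, (x, l) \in D) (occupied D x).
Proof.
rewrite /occupied ffunE; apply: (iffP card_gt0P) => -[l]; rewrite ?inE => h;
  by exists l; rewrite ?inE.
Qed.

Definition occupied_edge D : rel G :=
  fun x y => [&& edge x y, occupied D x & occupied D y].

Lemma occupied_edge_sym D : symmetric (occupied_edge D).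
Proof. by move=> x y; rewrite /occupied_edge edge_sym [occupied D x && _]andbC. Qed.

(** For an empty fiber over [t] this is just the singleton of [t]; hence the hypothesis
    [occupied D t] below. *)
Definition occupied_component D t : {set G} := [set x | connect (occupied_edge D) t x].

Lemma occupied_component_mem D t x :
  occupied D t -> x \in occupied_component D t -> occupied D x.
Proof.
move=> Dt; rewrite inE => /connectP[p]; case/lastP: p => [_ -> //|p y].
by rewrite rcons_path last_rcons => /andP[_ /and3P[_ _ Dy]] ->.
Qed.

Lemma occupied_component_path D t x :
  x \in occupied_component D t ->
  exists p, [/\ path (@edge G) x p, last x p = t, uniq (x :: p) &
    {subset x :: p <= occupied_component D t}].
Proof.
rewrite inE (sym_connect_sym (@occupied_edge_sym D)) => /connectP[p0 xp0 ->].
case/shortenP: xp0 => p xp Up _.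
exists p; split=> //; first by apply: sub_path xp => a b /andP[].
move=> y yp; rewrite inE (sym_connect_sym (@occupied_edge_sym D)).
case/splitPl: yp xp {Up} => p1 p2 <-; rewrite cat_path last_cat => /andP[_ p2P].
by apply/connectP; exists p2.
Qed.

(** [D'] stands for a later distribution that has not yet disturbed the component. Since [x] lies
    outside, putting it in front of a simple path inside keeps the path simple. *)
Lemma push_into_component D D' t x y l i :
  occupied D t ->
  (forall v j, v \in occupied_component D t -> ((v, j) \in D') = ((v, j) \in D)) ->
  x \notin occupied_component D t -> y \in occupied_component D t ->
  (x, l) \in D' -> (y, l) \in D' -> edge x y -> (t, i) \in peg_reach D'.
Proof.
move=> Dt D'E xC yC xD yD xy.
have [p [yp lp Up sp]] := occupied_component_path yC.
apply: (push_along_path i xD yD xy yp lp).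
  by rewrite cons_uniq Up andbT; apply: contra xC; apply: sp.
move=> v vp; have vC : v \in occupied_component D t by apply: sp; rewrite inE vp orbT.
by have /occupiedP[j vD] := occupied_component_mem Dt vC; exists j; rewrite D'E.
Qed.

(** A full fiber has a peg on whichever level the next vertex of the path uses. *)
Lemma full_in_component D t x i :
  occupied D t -> x \in occupied_component D t -> 2 <= fiber_count D x ->
  (t, i) \in peg_reach D.
Proof.
move=> Dt xC cx; have [[|y p] [/= xp lp Up sp]] := occupied_component_path xC.
  by apply: peg_reach_fiber; rewrite -lp.
have occ v : v \in x :: y :: p -> exists j, (v, j) \in D.
  by move=> /sp/(occupied_component_mem Dt)/occupiedP.
have [l yl] : exists l, (y, l) \in D by apply: occ; rewrite !inE eqxx orbT.
case/andP: xp => xy yp.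
apply: (push_along_path i (full_fiber l cx) yl xy yp lp Up) => v vp.
by apply: occ; rewrite !inE vp !orbT.
Qed.

Lemma pebbling_suffices_connect k p (x y : G) :
  0 < k -> 0 < p -> pebbling_suffices G k p -> connect (@edge G) x y.
Proof.
move=> k0 p0 Gp; have [//|nxy] := boolP (connect _ x y).
have := pebbling_disconnected k0 nxy; rewrite /least_positive.
by case: pselect => // -[]; exists p; apply/asboolP.
Qed.

Lemma peg_reach_two_levels D p t i :
  0 < p -> pebbling_suffices G 1 p -> p <= #|D| -> #|G| < #|D| ->
  (t, i) \in peg_reach D.
Proof.
move=> p0 Gp pD GD; rewrite -sum_fiber_count in pD.
have slow z := slow_pebbling_suffices z (isT : 1 <= 2) Gp pD.
have [Dt|nDt] := boolP (occupied D t); last first.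
  rewrite /occupied -eqn0Ngt in nDt.
  have [g [Dg gt]] := slow t.
  have [||D' [u [v [DD' uv _ /set1P vt [cu _]]]]] :=
      simulate_until_entering Dg (set11 t).
  - by rewrite (eqP nDt).
  - by move=> x /set1P ->; rewrite (eqP nDt).
  rewrite vt in uv; apply: peg_reach_trans DD' _.
  have [j ji] := other_level i.
  apply: (@peg_reach_jump GK D' (u, j) (u, i) (t, i)); rewrite ?full_fiber //.
    by rewrite edge_vertical.
  by rewrite edge_horizontal.
pose C := occupied_component D t.
have [/existsP[x /andP[xC cx]]|nfull] := boolP [exists x in C, 2 <= fiber_count D x].
  exact: full_in_component Dt xC cx.
have C1 x : x \in C -> fiber_count D x <= 1.
  move=> xC; rewrite leqNgt; apply: contra nfull => cx.
  by apply/existsP; exists x; rewrite xC.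
have tC : t \in C by rewrite inE connect0.
(* If no edge left [C], connectedness would make [C] all of [G], and one peg per fiber would give at
   most [#|G|] pegs. *)
have [s [z [sC zC sz]]] : exists s z, [/\ s \in C, z \notin C & edge s z].
  have [/existsP[s /existsP[z /and3P[? ? ?]]]|nex] :=
    boolP [exists s, exists z, [&& s \in C, z \notin C & edge s z]]; first by exists s, z.
  have Cclosed : closed (@edge G) C.
    apply: intro_closed; first exact/sym_connect_sym/edge_sym.
    move=> a b ab aC; apply: contraNT nex => bC.
    by apply/existsP; exists a; apply/existsP; exists b; rewrite aC bC.
  exfalso; move: GD; rewrite -sum_fiber_count ltnNge => /negP; apply.
  rewrite -sum1_card; apply: leq_sum => x _; apply: C1.
  by rewrite -(closed_connect Cclosed (pebbling_suffices_connect t x (ltn0Sn 0) p0 Gp)).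
have Ds := occupied_component_mem Dt sC.
have z0 : fiber_count D z = 0.
  apply/eqP; rewrite eqn0Ngt; apply: contra zC => Dz.
  rewrite inE in sC; rewrite inE; apply: connect_trans sC (connect1 _).
  by rewrite /occupied_edge sz Ds.
have [g [Dg gz]] := slow z.
(* Fibers over [z |: C] carry at most one peg each and [z] has to gain one, so some move enters this
   set. *)
have [||D' [u [v [DD' uv uT vT [cu D'E]]]]] := simulate_until_entering Dg (setU11 z C).
- by rewrite z0.
- by move=> x /setU1P[->|/C1//]; rewrite z0.
have uC : u \notin C by apply: contra uT; apply: setU1r.
apply: peg_reach_trans DD' _.
have D'C v' j : v' \in C -> ((v', j) \in D') = ((v', j) \in D).
  by move=> v'C; apply: D'E; rewrite setU1r.
(* If [z] is entered, the jump lands on the level of a peg over its neighbor [s], and this pair is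
   pushed into [C] from outside. *)
case/setU1P: vT => [vz|vC].
  have /occupiedP[l sl] := Ds.
  have [j jl] := other_level l.
  rewrite vz in uv.
  have zlD : (z, l) \notin D'.
    rewrite D'E ?setU11 //; apply/negP => zl.
    by have /occupiedP : exists l, (z, l) \in D by [exists l]; rewrite /occupied z0.
  have jump : peg_move D' ((z, l) |: (D' :\: [set (u, j); (u, l)])).
    apply: peg_jump (full_fiber j cu) (full_fiber l cu) _ zlD _.
      by rewrite edge_vertical.
    by rewrite edge_horizontal.
  apply: peg_reach_trans (connect1 jump) _.
  have D''E v' m : v' \in C ->
      ((v', m) \in (z, l) |: (D' :\: [set (u, j); (u, l)])) = ((v', m) \in D).
    move=> v'C; rewrite -D'C // !inE !xpair_eqE.
    by rewrite (negPf (memPn zC _ v'C)) (negPf (memPn uC _ v'C)).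
  apply: (push_into_component i Dt D''E zC sC (l := l)).
  - by rewrite setU11.
  - by rewrite D''E.
  - by rewrite edge_sym.
(* If [C] would be entered at [v], the full fiber over [u] already matches the level of the peg over
   [v]. *)
have /occupiedP[l vl] := occupied_component_mem Dt vC.
apply: (push_into_component i Dt D'C uC vC (l := l)) => //; first exact: full_fiber.
by rewrite D'C.
Qed.

End TwoLevels.

(** * The two bounds on the pegging number *)

Lemma least_positive_Some Q m : least_positive Q = Some m -> 0 < m /\ Q m.
Proof.
rewrite /least_positive; case: pselect => // exQ [<-].
by case: ex_minnP => n /asboolP.
Qed.

Lemma pegging_number_le (G : sgraph) d :
  0 < d -> (forall (D : {set G}) t, #|D| = d -> t \in peg_reach D) ->
  pegging_number G <= d.
Proof.
move=> d0 h; rewrite /pegging_number; case: ex_minnP => m _; apply.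
rewrite /pegging_suffices d0; apply/forallP=> D; apply/implyP=> /eqP cD.
by rewrite -subTset; apply/subsetP=> t _; apply: h.
Qed.

Theorem theorem4p3 (G : sgraph) :
  (forall n : nat, 0 < n ->
     enat_le (Some (pegging_number (cart_prod G (complete_graph n))))
             (two_pebbling_number G)) /\
  enat_le (Some (pegging_number (cart_prod G (complete_graph 2))))
          (enat_max (pebbling_number G) (Some (#|G| + 1))).
Proof.
split=> [n _|].
  case E: (two_pebbling_number G) => [d|] //=.
  have [d0 Gd] := least_positive_Some E.
  apply: pegging_number_le => // D [t i] cD.
  have dD : d <= \sum_x fiber_count D x by rewrite sum_fiber_count cD.
  have [g [Dg gt]] := slow_pebbling_suffices t (leqnn 2) Gd dD.
  have [D' DD' cD'] := simulate_slow_reach Dg.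
  by apply: peg_reach_trans DD' _; apply: peg_reach_fiber; rewrite cD'.
case E: (pebbling_number G) => [p|] //=.
have [p0 Gp] := least_positive_Some E.
apply: pegging_number_le => [|D [t i] cD]; first by rewrite leq_max p0.
by apply: (peg_reach_two_levels _ _ p0 Gp); rewrite cD leq_max ?leqnn // addn1 leqnn orbT.
Qed.
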